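(* Let $n\ge 1$. (i) If $\Omega$ is a bounded domain in $\mathbb C^n$, then $A(\overline\Omega)$ is not coherent, where $A(\overline\Omega)$ denotes the algebra of all continuous functions $f:\overline\Omega\to\mathbb C$ that are holomorphic in $\Omega$. (ii) If $K\subset\mathbb C^n$ is compact with nonempty interior $K^\circ$, then $A(K)$ is not coherent, where $A(K)$ denotes the algebra of all continuous functions $f:K\to\mathbb C$ that are holomorphic in $K^\circ$.
   Context: A domain is a nonempty connected open set. All algebras carry the pointwise operations. A commutative unital ring is called coherent if the intersection of any two finitely generated ideals is finitely generated. In part (i) holomorphy is required only on $\Omega$, which may be strictly smaller than the interior of $\overline\Omega$; so (i) is not a special case of (ii). *)

(* Defs.v *)
From HB Require Import structures.
From mathcomp Require Import all_boot all_order all_algebra.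
From mathcomp Require Import all_classical all_reals all_analysis.
From mathcomp Require Import complex.

Set Implicit Arguments.
Unset Strict Implicit.
Unset Printing Implicit Defensive.

Import Order.TTheory GRing.Theory Num.Theory.
Import numFieldNormedType.Exports.

Local Open Scope classical_set_scope.
Local Open Scope ring_scope.
Local Open Scope complex_scope.

(* R[i] with the topology of its modulus, as a normed space over itself; hence
   [differentiable] for functions on 'rV[R[i]]_n means complex (Frechet)
   differentiable. *)
HB.instance Definition _ (R : realType) := NormedModule.copy R[i] R[i]^o.

Section Coherence.
Variable A : comPzRingType.

Definition ideal_gen (m : nat) (a : 'I_m -> A) : set A :=
  [set x | exists c : 'I_m -> A, x = \sum_(i < m) c i * a i].

Definition fin_gen_ideal (I : set A) : Prop :=
  exists (m : nat) (a : 'I_m -> A), I = ideal_gen a.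

Definition coherent : Prop :=
  forall I J : set A,
    fin_gen_ideal I -> fin_gen_ideal J -> fin_gen_ideal (I `&` J).

End Coherence.

Section HolomorphicAlgebra.
Variables (R : realType) (n : nat).
Notation Cn := 'rV[R[i]]_n.

Definition is_domain (Omega : set Cn) : Prop :=
  [/\ Omega !=set0, connected Omega & open Omega].

(* To be used with U open. *)
Definition holomorphic_on (U : set Cn) (F : Cn -> R[i]) : Prop :=
  forall z, U z -> differentiable F z.

Variables (K U : set Cn).

(* Here U is an open subset of K.  As differentiability is stated for functions
   on the whole space, holomorphy in U of a function f on K is expressed through
   a (possibly discontinuous) extension F of f; only the values of f on U
   matter, so the choice of F outside K is irrelevant. *)
Definition holo_alg_pred : {pred K -> R[i]} := fun f : K -> R[i] =>
  `[< continuous f /\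
      exists2 F : Cn -> R[i],
        (forall z : K, F (val z) = f z) & holomorphic_on U F >].

Lemma holo_alg_subring_closed : subring_closed holo_alg_pred.
Proof.
split.
- apply/asboolP; split; first exact: cst_continuous.
  by exists (cst 1) => // z _; exact: differentiable_cst.
- move=> f g /asboolP[cf [F Ff dF]] /asboolP[cg [G Gg dG]].
  apply/asboolP; split; first by move=> z; exact: (continuousB (cf z) (cg z)).
  exists (F - G) => [z|z Uz]; last by apply: differentiableB; auto.
  by rewrite -[LHS]/(F (val z) - G (val z)) Ff Gg.
- move=> f g /asboolP[cf [F Ff dF]] /asboolP[cg [G Gg dG]].
  apply/asboolP; split; first by move=> z; exact: (continuousM (cf z) (cg z)).
  exists (F * G) => [z|z Uz]; last by apply: differentiableM; auto.
  by rewrite -[LHS]/(F (val z) * G (val z)) Ff Gg.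
Qed.

HB.instance Definition _ :=
  GRing.isSubringClosed.Build (K -> R[i]) holo_alg_pred holo_alg_subring_closed.

(* The ring of continuous functions on K that are holomorphic in U. *)
Definition holo_alg := {f : K -> R[i] | f \in holo_alg_pred}.

HB.instance Definition _ := SubChoice.on holo_alg.
HB.instance Definition _ :=
  GRing.SubChoice_isSubComPzRing.Build (K -> R[i]) holo_alg_pred holo_alg
    holo_alg_subring_closed.

End HolomorphicAlgebra.

(* Main.v *)
(* Let z0 maximise the real part of the i-th coordinate over the closure of the
   open set U, and put w(z) = z0_i - z_i, so that Re w > 0 on U.  Take f = w and
   g = w S(w), where S is bounded and holomorphic on the right half-plane but
   does not converge along some sequence z_k -> z0 in U.  If (f) /\ (g) is
   generated by h_j = f a_j = g b_j, then a_j = S b_j at the points z_k, which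
   forces b_j(z0) = 0.  Conversely S b is in the algebra whenever b is a function
   of w vanishing at w = 0, so g b = f (S b) lies in (f) /\ (g), and cancelling g
   gives b = sum_j c_j b_j at the points z_k where S does not vanish.  This fails
   for a b whose decay along a subsequence is slower than that of all the b_j.

   The shape of U near z0 is arbitrary (it may be a thin cone, or have infinitely
   many components accumulating at z0), so neither exp (- 1 / w) nor w ^ i can
   serve as S.  Both S and b are instead sums of simple fractions whose poles on
   the negative real axis are adapted to the sequence |w(z_k)|. *)
Require Import Defs.
From HB Require Import structures.
From mathcomp Require Import all_boot all_order all_algebra.
From mathcomp Require Import all_classical all_reals all_analysis.
From mathcomp Require Import complex.
From mathcomp Require Import ring lra.

Set Implicit Arguments.
Unset Strict Implicit.
Unset Printing Implicit Defensive.

Import Order.TTheory GRing.Theory Num.Theory.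
Import numFieldNormedType.Exports.
Import ComplexField.Normc.

Local Open Scope classical_set_scope.
Local Open Scope ring_scope.
Local Open Scope complex_scope.

Local Notation Re := complex.Re.
Local Notation Im := complex.Im.

Arguments normc : simpl never.

(** * Modulus and convergence in the complex numbers *)

Section ComplexTopology.
Variable R : realType.
Implicit Types (x y z : R[i]) (e : R).

Lemma normc_ge0 z : 0 <= normc z.
Proof. by case: z => a b; rewrite /normc sqrtr_ge0. Qed.

Lemma normcB x y : normc (x - y) = normc (y - x).
Proof. by rewrite -normcN opprB. Qed.

Lemma normc_eq0 z : (normc z == 0) = (z == 0).
Proof.
by apply/eqP/eqP => [/eq0_normc //|->]; rewrite normc0.
Qed.

Lemma normc_gt0 z : (0 < normc z) = (z != 0).
Proof. by rewrite lt_neqAle normc_ge0 andbT eq_sym normc_eq0. Qed.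

Lemma normc_real (a : R) : normc a%:C = `|a|.
Proof. by rewrite /normc /= expr0n addr0 sqrtr_sqr. Qed.

Lemma Re_le_normc z : `|Re z| <= normc z.
Proof. by move: (normc_ge_Re z); rewrite lecR. Qed.

Lemma Im_le_normc z : `|Im z| <= normc z.
Proof.
by case: z => a b; rewrite /normc /= -sqrtr_sqr ler_wsqrtr// lerDr sqr_ge0.
Qed.

Lemma normc_le_ReIm z : normc z <= `|Re z| + `|Im z|.
Proof.
case: z => a b; rewrite /normc /=.
rewrite -[leRHS]ger0_norm ?addr_ge0 // -sqrtr_sqr ler_wsqrtr // sqrrD !real_normK ?num_real //.
by rewrite lerD2r lerDl mulrn_wge0 // mulr_ge0.
Qed.

Lemma normc_sum (I : Type) (r : seq I) (P : pred I) (F : I -> R[i]) :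
  normc (\sum_(i <- r | P i) F i) <= \sum_(i <- r | P i) normc (F i).
Proof.
elim/big_ind2: _ => [|a b c d ab cd|//]; first by rewrite normc0.
by apply: (le_trans (le_normcD _ _)); exact: lerD.
Qed.

(** The norm of [R[i]] takes values in [R[i]] itself; this form moves every estimate to the
    real-valued [normc], where real arithmetic applies. *)
Lemma cvgcP (T : Type) (F : set_system T) {FF : Filter F} (f : T -> R[i]) z :
  f @ F --> z <-> forall e, 0 < e -> \forall t \near F, normc (z - f t) < e.
Proof.
split=> [/cvgrPdist_lt h e e0|h].
  have /h : 0 < e%:C by rewrite ltcR.
  by apply: filterS => t; rewrite ltcR.
apply/cvgrPdist_lt => -[a b]; rewrite ltcE /= => /andP[/eqP -> a0].
by move/h: a0; apply: filterS => t; rewrite ltcR.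
Qed.

Lemma nbhs_normc z e : 0 < e -> \forall x \near z, normc (z - x) < e.
Proof.
move=> e0; have h : idfun @ nbhs z --> z by exact: cvg_id.
by move/cvgcP: h; exact.
Qed.

Lemma Re_continuous : continuous (@Re R : R[i] -> R).
Proof.
move=> z; have E x : Re z - Re x = Re (z - x) by case: z; case: x.
 apply/(@cvgrPdist_lt _ _ _ (nbhs z)) => e e0.
near=> x; apply: (@le_lt_trans _ _ (normc (z - x))).
  by rewrite E Re_le_normc.
by near: x; exact: nbhs_normc.
Unshelve. all: by end_near. Qed.

Lemma Im_continuous : continuous (@Im R : R[i] -> R).
Proof.
move=> z; have E x : Im z - Im x = Im (z - x) by case: z; case: x.
 apply/(@cvgrPdist_lt _ _ _ (nbhs z)) => e e0.
near=> x; apply: (@le_lt_trans _ _ (normc (z - x))).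
  by rewrite E Im_le_normc.
by near: x; exact: nbhs_normc.
Unshelve. all: by end_near. Qed.

Lemma cvg_complex (T : Type) (F : set_system T) {FF : Filter F} (f g : T -> R) (a b : R) :
  f @ F --> a -> g @ F --> b -> (fun t => f t +i* g t) @ F --> a +i* b.
Proof.
move=> /cvgrPdist_lt fa /cvgrPdist_lt gb; apply/cvgcP => e e0.
have e20 : 0 < e / 2 by rewrite divr_gt0.
near=> t; rewrite (le_lt_trans (normc_le_ReIm _))//= (splitr e).
by rewrite ltrD//; near: t; [exact: fa | exact: gb].
Unshelve. all: by end_near. Qed.

Lemma complex_hausdorff : hausdorff_space R[i].
Proof. exact: norm_hausdorff. Qed.

Lemma cvgn_normc_le (u : nat -> R[i]) z B :
  u @ \oo --> z -> (\forall n \near \oo, normc (u n) <= B) -> normc z <= B.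
Proof.
move=> /cvgcP uz uB; apply/ler_addgt0Pr => e e0.
have [n [nB ne]] := @filter_ex _ _ _ _ (filterI uB (uz e e0)).
rewrite -(subrK (u n) z) (le_trans (le_normcD _ _))// addrC lerD//.
exact: ltW.
Qed.

(** * Absolutely convergent complex series *)

Definition csummable (u : nat -> R[i]) := cvgn (series (@normc R \o u)).

(** Taking limits of real and imaginary parts separately reduces convergence to that of absolutely
    convergent real series. The value is meaningful for summable [u]. *)
Definition csum (u : nat -> R[i]) : R[i] :=
  limn (series (@Re R \o u)) +i* limn (series (@Im R \o u)).
#[global] Arguments csum : simpl never.

Lemma csum_cvg u : csummable u -> series u @ \oo --> csum u.
Proof.
move=> su.
have cRe : cvgn (series (@Re R \o u)).
  by apply: normed_cvg; apply: series_le_cvg su => k //=; rewrite ?normc_ge0 ?Re_le_normc.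
have cIm : cvgn (series (@Im R \o u)).
  by apply: normed_cvg; apply: series_le_cvg su => k //=; rewrite ?normc_ge0 ?Im_le_normc.
rewrite (_ : series u = fun n => series (@Re R \o u) n +i* series (@Im R \o u) n).
  exact: cvg_complex.
apply/funext => n; rewrite /series /=.
elim: n => [|n IH]; first by rewrite !big_nil.
by rewrite !big_nat_recr //= IH; case: (u n).
Qed.

Lemma csummable_le (u : nat -> R[i]) (M : nat -> R) :
  (forall k, normc (u k) <= M k) -> cvgn (series M) -> csummable u.
Proof.
move=> uM cM; apply: series_le_cvg cM => k //=; first exact: normc_ge0.
exact: le_trans (normc_ge0 _) (uM k).
Qed.

Lemma csum_le (u : nat -> R[i]) (M : nat -> R) :
  (forall k, normc (u k) <= M k) -> cvgn (series M) ->
  forall N, normc (csum u - series u N) <= limn (series M) - series M N.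
Proof.
move=> uM cM N; have /csum_cvg cu := csummable_le uM cM.
apply: (@cvgn_normc_le (fun n => series u n - series u N)).
  exact: (cvgB cu (cvg_cst _)).
have M0 k : 0 <= M k := le_trans (normc_ge0 _) (uM k).
near=> n; have Nn : (N <= n)%N by near: n; exact: nbhs_infty_ge.
rewrite sub_series_geq//; apply: (le_trans (normc_sum _ _ _ )).
apply: (@le_trans _ _ (series M n - series M N)).
  by rewrite sub_series_geq// ler_sum.
rewrite lerD2r; apply: nondecreasing_cvgn_le => //.
by apply: nondecreasing_series => k *.
Unshelve. all: by end_near. Qed.

Lemma csum_unique u z : csummable u -> series u @ \oo --> z -> csum u = z.
Proof.
move=> /csum_cvg cu cz.
exact: (@cvg_unique _ complex_hausdorff _ _ _ _ cu cz).
Qed.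

Lemma csumZ c u : csummable u -> csum (fun k => c * u k) = c * csum u.
Proof.
move=> su; apply: csum_unique.
  rewrite /csummable (_ : _ \o _ = (fun k => normc c *: normc (u k))).
    rewrite [series _](_ : _ = normc c *: series (@normc R \o u)); last first.
      by apply/funext => n; rewrite /series /= -scaler_sumr.
    exact: is_cvgZr.
  by apply/funext => k /=; rewrite normcM.
rewrite (_ : series _ = (fun n => c * series u n)).
  exact: (cvgM (cvg_cst c) (csum_cvg su)).
by apply/funext => n; rewrite /series /= mulr_sumr.
Qed.

Lemma csumB u v : csummable u -> csummable v ->
  csum (fun k => u k - v k) = csum u - csum v.
Proof.
move=> su sv; apply: csum_unique.
  apply: (@csummable_le _ (fun k => normc (u k) + normc (v k))) => [k|].
    by rewrite -(normcN (v k)) le_normcD.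
  rewrite [series _](_ : _ = series (@normc R \o u) + series (@normc R \o v)).
    exact: is_cvgD.
  by apply/funext => n; rewrite /series /= big_split.
rewrite (_ : series _ = (fun n => series u n - series v n)).
  exact: (cvgB (csum_cvg su) (csum_cvg sv)).
by apply/funext => n; rewrite /series /= sumrB.
Qed.

Lemma cvgc_sum (I T : Type) (F : set_system T) {FF : Filter F} (r : seq I)
    (f : I -> T -> R[i]) (l : I -> R[i]) :
  (forall i, f i @ F --> l i) ->
  (fun t => \sum_(i <- r) f i t) @ F --> \sum_(i <- r) l i.
Proof.
move=> fl; elim: r => [|i r IH].
  rewrite big_nil [X in X @ _](_ : _ = cst 0); first exact: cvg_cst.
  by apply/funext => t; rewrite big_nil.
rewrite big_cons [X in X @ _](_ : _ = f i \+ (fun t => \sum_(j <- r) f j t)).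
  exact: (cvgD (fl i) IH).
by apply/funext => t; rewrite big_cons.
Qed.

(** Weierstrass M-test: the tails are bounded by those of [M] uniformly in [t], so a three-epsilon
    argument with one continuous partial sum applies. *)
Lemma csum_continuous (T : topologicalType) (u : nat -> T -> R[i]) (M : nat -> R) :
  (forall k t, normc (u k t) <= M k) -> cvgn (series M) ->
  (forall k, continuous (u k)) -> continuous (fun t => csum (u ^~ t)).
Proof.
move=> uM cM cu t; apply/cvgcP => e e0.
have e30 : 0 < e / 3 by rewrite divr_gt0.
have /cvgrPdist_lt/(_ _ e30) [N _ /(_ N (leqnn N))/= hN] := cM.
have cN : {for t, continuous (fun t => series (u ^~ t) N)}.
  exact: (@cvgc_sum _ _ (nbhs t) _ _ u (u ^~ t) (fun k => cu k t)).
have /cvgcP/(_ _ e30) := cN; apply: filterS => s /= hs.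
have tl (y : T) : normc (csum (u ^~ y) - series (u ^~ y) N) < e / 3.
  apply: le_lt_trans (csum_le (uM^~ y) cM N) _.
  exact: le_lt_trans (ler_norm _) hN.
rewrite (_ : csum (u ^~ t) - csum (u ^~ s) = (csum (u ^~ t) - series (u ^~ t) N)
   + (series (u ^~ t) N - series (u ^~ s) N)
   + (series (u ^~ s) N - csum (u ^~ s))); last by ring.
apply: (le_lt_trans (le_normcD _ _)).
apply: (le_lt_trans (lerD (le_normcD _ _) (lexx _))).
rewrite [X in _ + X]normcB.
by rewrite (_ : e = e/3 + e/3 + e/3); [rewrite !ltrD | lra].
Qed.

End ComplexTopology.

(** * Simple fractions on the right half-plane *)

Section HalfPlane.
Variable R : realType.
Implicit Types (v w z : R[i]) (d : R).

(* A point of K outside the closure of U may have Re w < 0.  There functions in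
   the algebra need only be continuous, so precomposing with this retraction onto
   the closed right half-plane extends functions of w from U to K. *)
Definition fold_Re (w : R[i]) : R[i] := `|Re w| +i* Im w.
#[global] Arguments fold_Re : simpl never.

Lemma fold_Re0 : fold_Re 0 = 0.
Proof. by rewrite /fold_Re /= normr0. Qed.

Lemma fold_Re_id w : 0 <= Re w -> fold_Re w = w.
Proof. by case: w => a b /= a0; rewrite /fold_Re /= ger0_norm. Qed.

Lemma Re_fold_Re_ge0 w : 0 <= Re (fold_Re w).
Proof. exact: normr_ge0. Qed.

Lemma normc_fold_Re w : normc (fold_Re w) = normc w.
Proof. by case: w => a b; rewrite /fold_Re /normc /= real_normK ?num_real. Qed.

Lemma fold_Re_eq0 w : (fold_Re w == 0) = (w == 0).
Proof. by rewrite -!normc_eq0 normc_fold_Re. Qed.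

Lemma fold_Re_continuous : continuous fold_Re.
Proof.
move=> w; rewrite /fold_Re.
apply: (@cvg_complex _ _ (nbhs w)); last exact: Im_continuous.
by apply: cvg_norm; exact: Re_continuous.
Qed.

Lemma near_Re_gt0 w : 0 < Re w -> \forall z \near w, 0 < Re z.
Proof.
move=> w0.
by near=> z; near: z; exact: (cvgr_gt _ (@Re_continuous R w)).
Unshelve. all: by end_near. Qed.

Lemma near_fold_Re w : 0 < Re w -> \forall z \near w, fold_Re z = z.
Proof.
move=> w0; near=> z; apply: fold_Re_id; apply: ltW; near: z.
exact: near_Re_gt0.
Unshelve. all: by end_near. Qed.

(** With nonnegative real part, adding [d] can only enlarge its square. Together with the next bound
    this keeps [v / (v + d)] and [d / (v + d)] in the closed unit disc. *)
Lemma normc_addr_ge v d : 0 <= Re v -> 0 < d -> normc v <= normc (v + d%:C).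
Proof.
case: v => a b /= a0 d0; rewrite /normc /= ler_wsqrtr// addr0 lerD2r.
by rewrite ler_sqr ?nnegrE ?addr_ge0 ?lerDl //; exact: ltW.
Qed.

Lemma normc_addr_ger v d : 0 <= Re v -> 0 < d -> d <= normc (v + d%:C).
Proof.
move=> v0 d0; apply: le_trans (Re_le_normc _).
by case: v v0 => a b /= v0; rewrite ger0_norm ?lerDr ?addr_ge0 //; exact: ltW.
Qed.

Lemma addr_neq0 v d : 0 <= Re v -> 0 < d -> v + d%:C != 0.
Proof.
by move=> v0 d0; rewrite -normc_gt0 (lt_le_trans d0)// normc_addr_ger.
Qed.

Lemma normc_div v z : normc (v / z) = normc v / normc z.
Proof. by rewrite normcM normcV. Qed.

Lemma shift_frac_le1 w d : 0 < d -> normc (fold_Re w / (fold_Re w + d%:C)) <= 1.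
Proof.
move=> d0; have v0 := Re_fold_Re_ge0 w; rewrite normc_div ler_pdivrMr ?mul1r.
  exact: normc_addr_ge.
by rewrite normc_gt0 addr_neq0.
Qed.

Lemma const_frac_le1 w d : 0 < d -> normc (d%:C / (fold_Re w + d%:C)) <= 1.
Proof.
move=> d0; have v0 := Re_fold_Re_ge0 w; rewrite normc_div ler_pdivrMr ?mul1r.
  by rewrite normc_real gtr0_norm// normc_addr_ger.
by rewrite normc_gt0 addr_neq0.
Qed.

Lemma inv_shift_le w d : 0 < d -> w != 0 ->
  normc (fold_Re w + d%:C)^-1 <= (normc w)^-1.
Proof.
move=> d0 w0; have v0 := Re_fold_Re_ge0 w.
rewrite normcV lef_pV2 ?posrE ?normc_gt0 ?addr_neq0//.
by rewrite -(normc_fold_Re w) normc_addr_ge.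
Qed.

Lemma inv_shift_continuous d : 0 < d ->
  continuous (fun w => (fold_Re w + d%:C)^-1).
Proof.
move=> d0 w; have v0 := addr_neq0 (Re_fold_Re_ge0 w) d0.
exact: (cvgV v0 (cvgD (@fold_Re_continuous w) (cvg_cst (d%:C : R[i])))).
Qed.

(** Continuity is asked on the whole plane because w may send points of K anywhere; derivability
    only on the open half-plane, which contains the image of U. *)
Definition half_plane_algebra (f : R[i] -> R[i]) :=
  continuous f /\ forall w, 0 < Re w -> derivable f w 1.

Lemma fold_Re_half_plane : half_plane_algebra fold_Re.
Proof.
split; first exact: fold_Re_continuous.
move=> w w0; apply: (@near_eq_derivable _ _ _ id); last exact: derivable_id.
by near=> z; apply/esym; near: z; exact: near_fold_Re.
Unshelve. all: by end_near. Qed.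

(* Caratheodory's form of differentiability *)
Lemma derivable_slope (f D : R[i] -> R[i]) w :
  {for w, continuous D} ->
  (\forall z \near w, f z = f w + (z - w) * D z) -> derivable f w 1.
Proof.
move=> cD fD.
apply: (@near_eq_derivable _ _ _ (fun z => f w + (z - w) * D z)).
  by near=> z; apply/esym; near: z.
apply/cvg_ex; exists (D w).
have cDs : D (h + w) @[h --> 0^'] --> D w.
  apply: cvg_within_filter.
  have cs : (h + w) @[h --> (0 : R[i])] --> 0 + w.
    exact: (cvgD (@cvg_id _ (nbhs (0 : R[i]))) (cvg_cst w)).
  by rewrite add0r in cs; exact: cvg_comp cs cD.
apply: cvg_trans cDs; apply: near_eq_cvg; near=> h.
rewrite /= subrr mul0r addr0 addrAC subrr add0r.
rewrite -[_ *: 1]/(h * 1) mulr1 addrK -[_ *: _]/(h^-1 * _) mulKf//.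
by near: h; exact: nbhs_dnbhs_neq.
Unshelve. all: by end_near. Qed.

End HalfPlane.

(** * Sums of simple fractions with poles on the negative real axis *)

Section FracSeries.
Variable R : realType.
Implicit Types (v w z : R[i]).

(** For positive [d] each fraction has modulus at most 1 and vanishes at 0, so an absolutely
    summable [s] gives uniform convergence. Both g and the test function b have this form. *)
Definition frac_series (s d : nat -> R) (w : R[i]) : R[i] :=
  csum (fun k => (s k)%:C * (fold_Re w / (fold_Re w + (d k)%:C))).

Lemma Re_mul_real (a : R) z : Re (a%:C * z) = a * Re z.
Proof. by case: z => x y /=; rewrite mul0r subr0. Qed.

Lemma normc_sign k : normc ((-1) ^+ k : R[i]) = 1.
Proof.
by rewrite -signr_odd; case: (odd k); rewrite ?expr0 ?expr1 ?normcN normc1.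
Qed.

Lemma Re_shift_frac v (d : R) : Re (v / (v + d%:C)) =
  (Re v ^+ 2 + Im v ^+ 2 + d * Re v) / ((Re v + d) ^+ 2 + Im v ^+ 2).
Proof.
case: v => a b /=; rewrite addr0.
by move: ((a + d) ^+ 2 + b ^+ 2) => q; ring.
Qed.

Lemma Re_shift_frac_ge0 v (d : R) : 0 <= Re v -> 0 < d -> 0 <= Re (v / (v + d%:C)).
Proof.
move=> v0 d0; rewrite Re_shift_frac divr_ge0 ?addr_ge0 ?sqr_ge0 ?mulr_ge0//.
exact: ltW.
Qed.

(** The Moebius map [v / (v + d)] commutes with conjugation and sends [- d] to infinity and [d] to
    1/2, so the circle of radius [d] about 0 goes to the vertical line through 1/2. *)
Lemma Re_shift_frac_half v (d : R) : 0 <= Re v -> 0 < d -> normc v = d ->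
  Re (v / (v + d%:C)) = 2^-1.
Proof.
move=> v0 d0 vd; have v2 : Re v ^+ 2 + Im v ^+ 2 = d ^+ 2.
  by rewrite -vd; case: v {v0 vd} => a b; rewrite /normc sqr_sqrtr ?addr_ge0 ?sqr_ge0.
rewrite Re_shift_frac (_ : (Re v + d) ^+ 2 + _ = 2 * (d ^+ 2 + d * Re v)).
  rewrite v2 invfM mulrCA divff ?mulr1// gt_eqF// ltr_wpDr ?exprn_gt0//.
  by rewrite mulr_ge0// ltW.
by rewrite -v2 sqrrD; lra.
Qed.

Section Summable.
Variables s d : nat -> R.
Hypothesis d_gt0 : forall k, 0 < d k.
Hypothesis s_sum : cvgn (series (fun k => `|s k|)).

Lemma frac_term_le k w :
  normc ((s k)%:C * (fold_Re w / (fold_Re w + (d k)%:C))) <= `|s k|.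
Proof.
by rewrite normcM normc_real ler_piMr // shift_frac_le1.
Qed.

Lemma frac_series_continuous : continuous (frac_series s d).
Proof.
apply: csum_continuous frac_term_le s_sum _ => k w.
exact: (cvgM (cvg_cst (s k)%:C)
  (cvgM (@fold_Re_continuous _ w) (inv_shift_continuous (d_gt0 k) (x:=w)))).
Qed.

Lemma frac_series0 : frac_series s d 0 = 0.
Proof.
rewrite /frac_series (_ : (fun _ => _) = (fun=> 0 * 0)).
  rewrite csumZ ?mul0r//; apply: csummable_le s_sum => k.
  by rewrite normc0.
by apply/funext => k; rewrite fold_Re0 mul0r !mulr0.
Qed.

Lemma frac_series_derivable w : 0 < Re w ->
  derivable (frac_series s d) w 1.
Proof.
move=> w0; have w_neq0 : w != 0 by apply: contraTneq w0 => ->; rewrite ltxx.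
(* The slope of [v / (v + d)] between w and z is [d / ((w + d) (z + d))]; [D] sums these slopes.
   Bounding [1 / (w + d k)] by [1 / |w|] gives a summable majorant, hence continuity of [D]. *)
pose D z := csum (fun k => ((s k)%:C * (w + (d k)%:C)^-1) *
                     ((d k)%:C / (fold_Re z + (d k)%:C))).
have ww : fold_Re w = w by rewrite fold_Re_id ?ltW.
have Dle k z : normc (((s k)%:C * (w + (d k)%:C)^-1) *
                     ((d k)%:C / (fold_Re z + (d k)%:C))) <= (normc w)^-1 *: `|s k|.
  rewrite normcM -[leRHS]mulr1 ler_pM ?normc_ge0 ?const_frac_le1//.
  rewrite normcM normc_real mulrC ler_wpM2r//.
  by have := inv_shift_le (d_gt0 k) w_neq0; rewrite ww.
have cs : cvgn (series (fun k => (normc w)^-1 *: `|s k|)).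
  rewrite [series _](_ : _ = (normc w)^-1 *: series (fun k => `|s k|)).
    exact: is_cvgZr.
  by apply/funext => n; rewrite /series /= -scaler_sumr.
apply: (@derivable_slope _ _ D).
  apply: (csum_continuous Dle cs) => k z.
  exact: (cvgM (cvg_cst _) (cvgM (cvg_cst _) (inv_shift_continuous (d_gt0 k) (x:=z)))).
near=> z; have zz : fold_Re z = z by near: z; exact: near_fold_Re.
have z0 : 0 < Re z by near: z; exact: near_Re_gt0.
apply/eqP; rewrite addrC -subr_eq; apply/eqP.
rewrite /frac_series -csumB; last 2 first.
- exact: csummable_le (fun k => frac_term_le k z) s_sum.
- exact: csummable_le (fun k => frac_term_le k w) s_sum.
rewrite /D -csumZ; last exact: csummable_le (fun k => Dle k z) cs.
congr csum; apply/funext => k; rewrite zz ww.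
have := addr_neq0 (ltW z0) (d_gt0 k); have := addr_neq0 (ltW w0) (d_gt0 k).
by move=> *; field; apply/andP.
Unshelve. all: by end_near. Qed.

Lemma frac_series_half_plane : half_plane_algebra (frac_series s d).
Proof. by split; [exact: frac_series_continuous|exact: frac_series_derivable]. Qed.

(** Every term has nonnegative real part, so the sum dominates its [k]-th term, whose fraction has
    real part exactly 1/2. *)
Lemma Re_frac_series_ge k w : (forall j, 0 <= s j) -> normc w = d k ->
  s k / 2 <= Re (frac_series s d w).
Proof.
move=> s0 wd; have v0 := Re_fold_Re_ge0 w.
pose t j := (s j)%:C * (fold_Re w / (fold_Re w + (d j)%:C)).
change (s k / 2 <= limn (series (@Re R \o t))).
have tE j : Re (t j) = s j * Re (fold_Re w / (fold_Re w + (d j)%:C)).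
  exact: Re_mul_real.
have t0 j : 0 <= Re (t j) by rewrite tE mulr_ge0 ?Re_shift_frac_ge0.
apply: (@le_trans _ _ (series (@Re R \o t) k.+1)).
  rewrite seriesSr -[leLHS]add0r; apply: lerD.
    by rewrite /series sumr_ge0// => j _; exact: t0.
  rewrite (_ : (_ \o _) k = s k / 2)// -[LHS]/(Re (t k)) tE.
  by rewrite Re_shift_frac_half ?normc_fold_Re.
apply: nondecreasing_cvgn_le; first by apply: nondecreasing_series => j _ _; exact: t0.
apply: series_le_cvg s_sum => // j.
exact: le_trans (ler_norm _) (le_trans (Re_le_normc _) (frac_term_le j w)).
Qed.

End Summable.

(** * The alternating series and its staircase factor *)

Section Alternating.
Variable d : nat -> R.
Hypothesis d_gt0 : forall k, 0 < d k.
Hypothesis d_half : forall k, 2 * d k.+1 <= d k.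

(** Halving gives [d j <= 2 * d j - 2 * d j.+1], which telescopes; keeping the last term makes the
    induction close. *)
Lemma sum_lacunary N m : \sum_(j < m) d (N + j) + 2 * d (N + m) <= 2 * d N.
Proof.
elim: m => [|m IH]; first by rewrite big_ord0 add0r addn0.
apply: le_trans IH; rewrite big_ord_recr /= -addrA lerD2l addnS.
by have := d_half (N + m); lra.
Qed.

(** The reciprocals at least double at each step, so the last one controls the sum. *)
Lemma sum_inv_lacunary N : \sum_(j < N.+1) (d j)^-1 <= 2 * (d N)^-1.
Proof.
elim: N => [|N IH].
  by rewrite big_ord_recr big_ord0 /= add0r ler_peMl ?invr_ge0 ?ltW// ltr1n.
rewrite big_ord_recr /=.
have : 2 * (d N)^-1 <= (d N.+1)^-1.
  by rewrite ler_pdivrMr// mulrC ler_pdivlMr.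
by move: IH; lra.
Qed.

Lemma lacunary_summable : cvgn (series d).
Proof.
apply: nondecreasing_is_cvgn.
  by apply: nondecreasing_series => k *; exact: ltW.
exists (2 * d 0%N) => _ [n _ <-]; rewrite /series /= big_mkord.
apply: le_trans (sum_lacunary 0 n); rewrite lerDl mulr_ge0// ltW//.
Qed.

(** With these coefficients [frac_series s d] is w times the staircase, that is, the function g. *)
Let s k : R := (-1) ^+ k * d k.

Lemma norm_alternating k : `|s k| = d k.
Proof. by rewrite /s normrM normrX normrN1 expr1n mul1r gtr0_norm. Qed.

Lemma alternating_summable : cvgn (series (fun k => `|s k|)).
Proof.
by rewrite (funext norm_alternating); exact: lacunary_summable.
Qed.

Lemma sum_signs N : \sum_(0 <= j < N) (-1) ^+ j = (odd N)%:R :> R[i].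
Proof.
elim: N => [|N IH]; first by rewrite big_nil.
by rewrite big_nat_recr//= IH -signr_odd; case: (odd N) => /=; rewrite ?subrr ?add0r ?expr0.
Qed.

(* The summands are close to (-1) ^ k for |w| much smaller than d k and to 0 for
   |w| much larger, so the sum is close to 1 or 0 according to the parity of the
   number of k with |w| < d k. *)
Definition staircase w := csum (fun k => (-1) ^+ k * ((d k)%:C / (fold_Re w + (d k)%:C))).

Lemma staircase_term_le w k : w != 0 ->
  normc ((-1) ^+ k * ((d k)%:C / (fold_Re w + (d k)%:C)) : R[i]) <= (normc w)^-1 * d k.
Proof.
move=> w0; rewrite !normcM normc_sign mul1r normc_real gtr0_norm// mulrC.
by rewrite ler_wpM2r ?inv_shift_le// ltW.
Qed.

Lemma staircase_summable w : w != 0 ->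
  csummable (fun k => (-1) ^+ k * ((d k)%:C / (fold_Re w + (d k)%:C)) : R[i]).
Proof.
move=> w0; apply: csummable_le (fun k => staircase_term_le k w0) _.
rewrite [series _](_ : _ = (normc w)^-1 *: series d).
  by apply: is_cvgZr; exact: lacunary_summable.
by apply/funext => n; rewrite /series /= -scaler_sumr.
Qed.

Lemma frac_series_staircase w : w != 0 ->
  frac_series s d w = fold_Re w * staircase w.
Proof.
move=> w0; rewrite /staircase -csumZ; last exact: staircase_summable.
rewrite /frac_series; congr csum; apply/funext => k.
by rewrite /s rmorphM rmorphXn rmorphN1; ring.
Qed.

(** Split the series at [N]. Replacing the fractions before [N] by 1 costs at most [|w| / d j] each,
    dropping the later ones at most [d j / |w|] each; by lacunarity either error sums to at most
    [2 * e]. *)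
Lemma staircase_approx w (e : R) N : w != 0 ->
  (forall j, (j < N)%N -> normc w <= e * d j) -> d N <= e * normc w ->
  normc (staircase w - (odd N)%:R) <= 4 * e.
Proof.
move=> w0 hlo hhi; have nw : 0 < normc w by rewrite normc_gt0.
have e0 : 0 <= e.
  by have := le_trans (ltW (d_gt0 N)) hhi; rewrite pmulr_lge0.
have inv_sum : \sum_(0 <= j < N) normc w * (d j)^-1 <= 2 * e.
  rewrite big_mkord -mulr_sumr; case: N hlo {hhi} => [_|N hlo].
    by rewrite big_ord0 mulr0 mulr_ge0.
  apply: (le_trans (ler_wpM2l (ltW nw) (sum_inv_lacunary N))).
  by rewrite mulrCA ler_wpM2l// ler_pdivrMr// hlo.
set u := (fun k => (-1) ^+ k * ((d k)%:C / (fold_Re w + (d k)%:C)) : R[i]).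
have cu : series u @ \oo --> staircase w := csum_cvg (staircase_summable w0).
apply: (@cvgn_normc_le _ (fun n => series u n - (odd N)%:R)).
  exact: (cvgB cu (cvg_cst _)).
near=> n; have Nn : (N <= n)%N by near: n; exact: nbhs_infty_ge.
rewrite -sum_signs /series /= (big_cat_nat (n := N))//= addrAC -sumrB.
apply: le_trans (le_normcD _ _) _.
rewrite (_ : 4 * e = 2 * e + 2 * e); last by ring.
apply: lerD; apply: (le_trans (normc_sum _ _ _)).
- apply: (le_trans _ inv_sum); apply: ler_sum => j _; rewrite /u.
  have dn := addr_neq0 (Re_fold_Re_ge0 w) (d_gt0 j).
  rewrite (_ : _ - _ = (-1) ^+ j * (- (fold_Re w / (fold_Re w + (d j)%:C)))).
    rewrite normcM normc_sign mul1r normcN normc_div normc_fold_Re.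
    rewrite ler_wpM2l ?normc_ge0// lef_pV2 ?posrE ?normc_gt0//.
    by rewrite normc_addr_ger// Re_fold_Re_ge0.
  by field.
- apply: (@le_trans _ _ (\sum_(N <= j < n) (normc w)^-1 * d j)).
    by apply: ler_sum => j _; exact: staircase_term_le.
  rewrite -mulr_sumr -{1}(add0n N) big_addn.
  rewrite mulrC ler_pdivrMr// -mulrA.
  apply: (@le_trans _ _ (2 * d N)); last by rewrite ler_wpM2l.
  apply: le_trans (sum_lacunary N (n - N)); rewrite big_mkord.
  under eq_bigr do rewrite addnC.
  by rewrite lerDl mulr_ge0// ltW.
Unshelve. all: by end_near. Qed.

(** Take [e = 1] in the approximation and [N] the first index with [d N <= |w|]: the error is at
    most 4 and the approximating value is 0 or 1. *)
Lemma staircase_bounded w : w != 0 -> normc (staircase w) <= 5.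
Proof.
move=> w0; have nw : 0 < normc w by rewrite normc_gt0.
have : exists N, d N <= normc w.
  have /cvgrPdist_le/(_ _ nw) [N _ /(_ N (leqnn N))] :=
    cvg_series_cvg_0 lacunary_summable.
  by rewrite /= sub0r normrN gtr0_norm// => ?; exists N.
move=> /ex_minnP [N dN Nmin].
have := @staircase_approx w 1 N w0; rewrite !mul1r mulr1 => /(_ _ dN) h.
rewrite -(subrK (odd N)%:R (staircase w)) (le_trans (le_normcD _ _))//.
rewrite (_ : 5 = 4 + 1); last by lra.
apply: lerD.
  apply: h => j jN; rewrite mul1r; apply: ltW; rewrite ltNge; apply/negP => /Nmin.
  by rewrite leqNgt jN.
by case: (odd N); rewrite ?normc1 ?normc0.
Qed.

(* The function is f * staircase, with the junk value _ / 0 = 0 providing the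
   right value at 0. *)
Lemma staircase_mul_half_plane f : half_plane_algebra f -> f 0 = 0 ->
  half_plane_algebra (fun w => frac_series s d w * f w / fold_Re w).
Proof.
move=> [cf df] f0; have sS := alternating_summable.
split=> w; last first.
  move=> w0; have w_neq0 : w != 0 by apply: contraTneq w0 => ->; rewrite ltxx.
  apply: derivableM; last first.
    apply: derivableV; first by rewrite fold_Re_eq0.
    exact: (fold_Re_half_plane R).2.
  by apply: derivableM; [exact: frac_series_derivable|exact: df].
have [->|w0] := eqVneq w 0; last first.
  have v0 : fold_Re w != 0 by rewrite fold_Re_eq0.
  exact: (cvgM (cvgM (frac_series_continuous d_gt0 sS (x:=w)) (cf w))
     (cvgV v0 (@fold_Re_continuous R w))).
rewrite /continuous_at fold_Re0 invr0 mulr0.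
apply/(@cvgcP _ _ (nbhs (0 : R[i]))) => e e0.
have e50 : 0 < e / 5 by rewrite divr_gt0.
have /(@cvgcP _ _ (nbhs (0 : R[i])))/(_ _ e50) := cf 0; rewrite f0.
apply: filterS => z; rewrite !sub0r !normcN => fz.
have [->|z0] := eqVneq z 0; first by rewrite f0 mulr0 mul0r normc0.
have -> : frac_series s d z * f z / fold_Re z = f z * staircase z.
  by rewrite frac_series_staircase//; field; rewrite fold_Re_eq0.
rewrite normcM (le_lt_trans (ler_wpM2l _ (staircase_bounded z0)))//.
  by rewrite normc_ge0.
by rewrite -ltr_pdivlMr.
Qed.

End Alternating.
End FracSeries.

(** * Generators and principal ideals *)

Section IdealGen.
Variable A : comPzRingType.

Lemma ideal_gen_mem m (a : 'I_m -> A) j : ideal_gen a (a j).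
Proof.
exists (fun i => (i == j)%:R); rewrite (bigD1 j)//= eqxx mul1r.
by rewrite big1 ?addr0// => i /negbTE ->; rewrite mul0r.
Qed.

Lemma principal_idealP (a x : A) :
  ideal_gen (fun _ : 'I_1 => a) x <-> exists c, x = c * a.
Proof.
split=> [[c ->]|[c ->]]; first by exists (c ord0); rewrite big_ord1.
by exists (fun=> c); rewrite big_ord1.
Qed.

Lemma principal_fin_gen (a : A) : fin_gen_ideal (ideal_gen (fun _ : 'I_1 => a)).
Proof. by exists 1%N, (fun=> a). Qed.

End IdealGen.

(** * Functions of w on K, and sequences in U tending to z0 *)

Section Peak.
Variables (R : realType) (n : nat) (K U : set 'rV[R[i]]_n) (i0 : 'I_n).
Variable z0 : 'rV[R[i]]_n.
Hypothesis UK : U `<=` K.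
Hypothesis Kz0 : K z0.
Hypothesis clUz0 : closure U z0.
Hypothesis Re_gt0 : forall z, U z -> 0 < Re (z0 ord0 i0 - z ord0 i0).

Let w (z : 'rV[R[i]]_n) : R[i] := z0 ord0 i0 - z ord0 i0.

Lemma support_continuous : continuous w.
Proof.
move=> z; exact: (cvgB (cvg_cst _) (@coord_continuous _ _ _ ord0 i0 z)).
Qed.

Lemma support_differentiable z : differentiable w z.
Proof.
apply: differentiableB; first exact: differentiable_cst.
exact: differentiable_coord.
Qed.

Lemma pullback_holo (f : R[i] -> R[i]) : half_plane_algebra f ->
  (fun z : K => f (w (val z))) \in holo_alg_pred U.
Proof.
move=> [cf df]; apply/asboolP; split.
  move=> z; apply: continuous_comp; last exact: cf.
  apply: continuous_comp; last exact: support_continuous.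
  exact: initial_continuous.
exists (f \o w) => // z Uz; apply: differentiable_comp.
  exact: support_differentiable.
by apply/derivable1_diffP; apply: df; exact: Re_gt0.
Qed.

Definition pullback f (hf : half_plane_algebra f) : holo_alg K U :=
  exist (fun g => g \in holo_alg_pred U) _ (pullback_holo hf).

Definition eval (z : K) (x : holo_alg K U) : R[i] := val x z.

Lemma evalM z x y : eval z (x * y) = eval z x * eval z y.
Proof. by []. Qed.

Lemma eval_sum z (I : Type) (r : seq I) (x : I -> holo_alg K U) :
  eval z (\sum_(i <- r) x i) = \sum_(i <- r) eval z (x i).
Proof.
elim: r => [|i r IH]; first by rewrite !big_nil.
by rewrite !big_cons -IH.
Qed.

Lemma eval_continuous x : continuous (eval ^~ x).
Proof. by move: (svalP x) => /asboolP[]. Qed.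

Lemma support_neq0 z : U z -> w z != 0.
Proof. by move=> /Re_gt0; apply: contraTneq; rewrite -/(w z) => ->; rewrite ltxx. Qed.

Lemma nearby_point (e : R) : 0 < e ->
  exists z, [/\ U z, `|z0 - z| < e%:C & normc (w z) < e].
Proof.
move=> e0.
have B1 : nbhs z0 [set z | `|z0 - z| < e%:C].
  have /cvgrPdist_lt : id @ nbhs z0 --> z0 by exact: cvg_id.
  by apply; rewrite ltcR.
have B2 : nbhs z0 [set z | normc (w z) < e].
  have /(@cvgcP _ _ (nbhs z0))/(_ e e0) := @support_continuous z0.
  by apply: filterS => z /=; rewrite /w subrr sub0r normcN.
have [z [Uz [h1 h2]]] := clUz0 (filterI B1 B2).
by exists z.
Qed.

(** Each new point is chosen close to z0 as well as with small w, since small w alone does not force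
    closeness to z0. The two factors 16 leave room for a pole radius well separated from both
    neighbouring values of [|w|]. *)
Lemma approach_sequence : exists zs : nat -> 'rV[R[i]]_n,
  [/\ forall k, U (zs k), zs @ \oo --> z0 &
      forall k, 16 * (16 * normc (w (zs k.+1))) <= normc (w (zs k))].
Proof.
have step (z : {z | U z}) : {y : {y | U y} | `|z0 - sval y| < (normc (w (sval z)) / 16 / 16)%:C
    /\ normc (w (sval y)) < normc (w (sval z)) / 16 / 16}.
  apply: cid; case: z => z Uz /=.
  have nz : 0 < normc (w z) by rewrite normc_gt0; exact: support_neq0.
  have e0 : 0 < normc (w z) / 16 / 16 by lra.
  have [y [Uy h1 h2]] := nearby_point e0.
  by exists (exist _ y Uy).
have [x0 [Ux0 _ _]] := nearby_point ltr01.
pose zs k := iter k (fun z => sval (step z)) (exist U x0 Ux0).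
have zsS k : `|z0 - sval (zs k.+1)| < (normc (w (sval (zs k))) / 16 / 16)%:C
    /\ normc (w (sval (zs k.+1))) < normc (w (sval (zs k))) / 16 / 16 by exact: svalP (step (zs k)).
exists (fun k => sval (zs k)); split=> [k||k].
- exact: svalP (zs k).
- have wle k : normc (w (sval (zs k))) <= geometric (normc (w x0)) 2^-1 k.
    elim: k => [|k IH]; first by rewrite /geometric /= expr0 mulr1.
    have [_ h] := zsS k; move: IH h; rewrite /geometric /= exprS.
    have := normc_ge0 (w (sval (zs k))); lra.
  (* [step] bounds the distance from z0 to the successor of a point, hence the shift. *)
  rewrite -cvg_shiftS; apply/cvgrPdist_lt => -[e e'].
  rewrite ltcE /= => /andP[/eqP -> e0].
  have h2 : `|2^-1 : R| < 1 by rewrite ger0_norm ?invr_ge0// invf_lt1// ltr1n.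
  have /cvgrPdist_lt/(_ _ e0) := cvg_geometric (normc (w x0)) h2.
  apply: filterS => k; rewrite sub0r normrN => gk.
  have [zk _] := zsS k; apply: (lt_trans zk); rewrite ltcR.
  have := le_lt_trans (le_trans (wle k) (ler_norm _)) gk.
  by have := normc_ge0 (w (sval (zs k))); lra.
- by have [_] := zsS k; lra.
Qed.

Lemma cvg_subtype (zs : nat -> K) (z : K) :
  (fun k => set_val (zs k)) @ \oo --> set_val z -> zs @ \oo --> z.
Proof.
move=> cz V [_ [[W oW <-] Wz WV]].
have /cz : nbhs (set_val z) W by exact: open_nbhs_nbhs.
move=> h; change (\forall k \near \oo, V (zs k)).
by near=> k; apply: WV; near: k.
Unshelve. all: by end_near. Qed.

(** * Oscillation of the staircase along the sequence *)

Section Oscillation.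
Variable zs : nat -> K.
Hypothesis Uzs : forall k, U (set_val (zs k)).
Variable zK : K.
Hypothesis zs_cvg : zs @ \oo --> zK.
Let rho k := normc (w (set_val (zs k))).
Hypothesis rho_lacunary : forall k, 16 * (16 * rho k.+1) <= rho k.

(** This radius is 16 times smaller than [rho k] and at least 16 times larger than [rho k.+1], so
    exactly the radii of index below [k] exceed [rho k], and the staircase error there is at most
    4/16. *)
Let d k := rho k / 16.

Lemma rho_gt0 k : 0 < rho k.
Proof. by rewrite normc_gt0 support_neq0. Qed.

Lemma radius_gt0 k : 0 < d k.
Proof. by rewrite divr_gt0// rho_gt0. Qed.

Lemma radius_half k : 2 * d k.+1 <= d k.
Proof.
by rewrite /d; have := rho_lacunary k; have := rho_gt0 k.+1; lra.
Qed.

Lemma rho_le j k : (j < k)%N -> 16 * (16 * rho k) <= rho j.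
Proof.
elim: k => // k IH; rewrite ltnS leq_eqVlt => /orP[/eqP ->//|/IH].
by have := rho_lacunary k; have := rho_gt0 k.+1; lra.
Qed.

Let S k := staircase d (w (set_val (zs k))).

Lemma staircase_along k : normc (S k - (odd k)%:R) <= 4^-1.
Proof.
have -> : (4^-1 : R) = 4 * 16^-1 by lra.
apply: (staircase_approx radius_gt0 radius_half).
- exact: support_neq0.
- by move=> j /rho_le; rewrite -/(rho k) /d; lra.
- by rewrite -/(rho k) /d mulrC.
Qed.

Lemma staircase_odd_neq0 k : odd k -> S k != 0.
Proof.
move=> ok; have := staircase_along k; rewrite ok.
by apply: contraTneq => ->; rewrite sub0r normcN normc1 -ltNge; lra.
Qed.

(** The staircase is near 0 at even indices and near 1 at odd ones, so a nonzero limit of [b] would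
    give [a] two incompatible limits. *)
Lemma staircase_lim0 (a b : holo_alg K U) :
  (forall k, eval (zs k) a = eval (zs k) b * S k) -> eval zK b = 0.
Proof.
move=> ab; apply/eqP/negPn/negP => B0.
set B := eval zK b in B0 *; set A := eval zK a.
have nB : 0 < normc B by rewrite normc_gt0.
pose e := normc B / 8; have e0 : 0 < e by rewrite divr_gt0.
have /cvgcP/(_ e e0) ca : (fun k => eval (zs k) a) @ \oo --> A.
  exact: cvg_comp zs_cvg (@eval_continuous a zK).
have /cvgcP/(_ e e0) cb : (fun k => eval (zs k) b) @ \oo --> B.
  exact: cvg_comp zs_cvg (@eval_continuous b zK).
have [N _ hN] := filterI ca cb.
have h2 : (N <= N.*2)%N by rewrite -addnn leq_addr.
have [/= a1 b1] := hN N.*2 h2.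
have [/= a2 b2] := hN N.*2.+1 (leqW h2).
have nb x : normc (B - x) < e -> normc x <= normc B + e.
  move=> /ltW Bx; rewrite -(subrK B x) addrC (le_trans (le_normcD _ _))// lerD2l.
  by rewrite normcB.
have s1 := staircase_along N.*2; have s2 := staircase_along N.*2.+1.
rewrite /= odd_double/= subr0 in s1; rewrite /= odd_double/= in s2.
have a1' : normc (eval (zs N.*2) a) <= (normc B + e) * 4^-1.
  by rewrite ab normcM ler_pM ?normc_ge0// nb.
have a2' : normc (eval (zs N.*2.+1) a - eval (zs N.*2.+1) b) <= (normc B + e) * 4^-1.
  rewrite ab -[X in _ - X]mulr1 -mulrBr normcM ler_pM ?normc_ge0// nb//.
set x1 := eval (zs N.*2) a in a1 a1'; set x2 := eval (zs N.*2.+1) a in a2 a2'.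
set y2 := eval (zs N.*2.+1) b in b2 a2'.
(* Three terms are below [e] and two are at most [(|B| + e) / 4]; for [e = |B| / 8] the total is
   below [15/16 * |B|], a contradiction. *)
have : normc B <= normc (B - y2) +
    (normc (y2 - x2) + (normc (x2 - A) + (normc (A - x1) + normc x1))).
  rewrite [X in normc X <= _](_ : B = (B - y2) +
    ((y2 - x2) + ((x2 - A) + ((A - x1) + x1)))); last by ring.
  by do 4 (apply: (le_trans (le_normcD _ _)); rewrite lerD2l).
rewrite (normcB y2) (normcB x2 A).
by rewrite /e in a1 b1 a2 b2 a1' a2'; lra.
Qed.

End Oscillation.

(** * Failure of coherence at the peak point *)

Lemma not_coherent_of_peak : ~ coherent (holo_alg K U).
Proof.
move=> coh; have [ys [Uys ys_cvg lac]] := approach_sequence.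
pose zs k : K := SigSub (mem_set (UK (Uys k))).
pose zK : K := SigSub (mem_set Kz0).
have zs_cvg : zs @ \oo --> zK by exact: cvg_subtype.
pose rho k := normc (w (set_val (zs k))).
pose d k := rho k / 16.
have Uzs k : U (set_val (zs k)) by exact: Uys.
have dp := radius_gt0 Uzs; have dh := radius_half Uzs lac.
pose s k : R := (-1) ^+ k * d k.
have gH : half_plane_algebra (frac_series s d).
  exact: frac_series_half_plane (alternating_summable dp dh).
pose f := pullback (fold_Re_half_plane R); pose g := pullback gH.
pose S k := staircase d (w (set_val (zs k))).
have fE k : eval (zs k) f = w (ys k).
  by rewrite -[LHS]/(fold_Re (w (ys k))) fold_Re_id// ltW// Re_gt0.
have gE k : eval (zs k) g = eval (zs k) f * S k.
  exact: (frac_series_staircase dp dh (support_neq0 (Uys k))).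
have f_neq0 k : eval (zs k) f != 0 by rewrite fE support_neq0.
have [m [h hE]] := coh _ _ (principal_fin_gen f) (principal_fin_gen g).
have hI j : exists ab : holo_alg K U * holo_alg K U, h j = ab.1 * f /\ h j = ab.2 * g.
  have := ideal_gen_mem h j; rewrite -hE => -[/principal_idealP[a ha] /principal_idealP[b hb]].
  by exists (a, b).
have [ab habE] := choice hI.
pose b j := (ab j).2.
(* Along the sequence a f = b g = b S f, and f can be cancelled because it does not vanish there. *)
have b0 j : eval zK (b j) = 0.
  apply: (staircase_lim0 Uzs zs_cvg lac (a := (ab j).1)) => k.
  have [ha hb] := habE j; apply: (mulIf (f_neq0 k)).
  by rewrite -mulrA [S k * _]mulrC -gE -!evalM -ha -hb.
have bcvg j : (fun k => eval (zs k) (b j)) @ \oo --> 0.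
  by rewrite -(b0 j); exact: cvg_comp zs_cvg (@eval_continuous (b j) zK).
(* Odd indices make the staircase nonzero, so that g can be cancelled; [4^-1 ^+ k] is chosen to beat
   the size [2^-1 ^+ k] of the test function; [k <= l] makes the chosen indices tend to infinity. *)
have small k : exists l, (k <= l)%N /\
    forall j, normc (eval (zs l.*2.+1) (b j)) < 4^-1 ^+ k.
  have e0 : 0 < (4^-1 : R) ^+ k by rewrite exprn_gt0// invr_gt0.
  have : \forall l \near \oo, forall j, normc (eval (zs l) (b j)) < 4^-1 ^+ k.
    apply: filter_forall => j; have /cvgcP/(_ _ e0) := bcvg j.
    by apply: filterS => l; rewrite sub0r normcN.
  move=> [N _ hN]; exists (maxn k N); split; first exact: leq_maxl.
  move=> j; apply: hN; apply: leqW; rewrite -addnn.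
  by apply: (leq_trans (leq_maxr k N)); exact: leq_addr.
have [l hl] := choice small.
pose N k := (l k).*2.+1.
(* [frac_series s2 d2] is at least 2 ^- k.+1 in real part at the point zs (N k),
   where each b j is at most 4 ^- k. *)
pose s2 k : R := 2^-1 ^+ k; pose d2 k := rho (N k).
have d2p k : 0 < d2 k by exact: rho_gt0.
have s2p k : 0 <= s2 k by rewrite exprn_ge0// invr_ge0.
have s2sum : cvgn (series (fun k => `|s2 k|)).
  rewrite [X in series X](_ : _ = geometric 1 2^-1).
    by apply: is_cvg_geometric_series; rewrite ger0_norm ?invr_ge0// invf_lt1// ltr1n.
  by apply/funext => k; rewrite /geometric /= mul1r ger0_norm.
have bH := frac_series_half_plane d2p s2sum.
have B0 := frac_series0 d2 s2sum.
have aH := staircase_mul_half_plane dp dh bH B0.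
pose x := pullback bH * g.
have : ideal_gen h x.
  rewrite -hE; split; apply/principal_idealP; last by exists (pullback bH).
  (* The cofactor of f is b times the staircase. Where w = 0, as at z0, both products vanish because
     b(0) = 0 and [fold_Re 0 = 0]. *)
  exists (pullback aH); apply/val_inj/funext => z.
  rewrite -[LHS]/(frac_series s2 d2 (w (set_val z)) * frac_series s d (w (set_val z))).
  rewrite -[RHS]/(frac_series s d (w (set_val z)) * frac_series s2 d2 (w (set_val z))
    / fold_Re (w (set_val z)) * fold_Re (w (set_val z))).
  have [->|wz] := eqVneq (w (set_val z)) 0.
    by rewrite B0 fold_Re0 mulr0 mul0r.
  by rewrite divfK ?fold_Re_eq0// mulrC.
move=> [c xE].
have bE k : eval (zs (N k)) (pullback bH) =
    \sum_(j < m) eval (zs (N k)) (c j) * eval (zs (N k)) (b j).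
  have gN : eval (zs (N k)) g != 0.
    rewrite gE mulf_neq0//; apply: (staircase_odd_neq0 Uzs lac).
    by rewrite /N /= odd_double.
  apply: (mulIf gN); rewrite -evalM -/x xE eval_sum mulr_suml.
  by apply: eq_bigr => j _; have [_ ->] := habE j; rewrite !evalM mulrA.
have Ncvg : N @ \oo --> \oo.
  move=> P [M _ hM]; exists M => // k /= Mk; apply: hM => /=.
  by rewrite (leq_trans Mk)// /N leqW// (leq_trans (hl k).1)// -addnn leq_addr.
have zN : (zs \o N) @ \oo --> zK by exact: cvg_comp Ncvg zs_cvg.
(* Rescaling by [2 ^+ k] sends each [b j] to 0, as [2 ^+ k * 4^-1 ^+ k] does, so [t] tends to 0; yet
   [t k] is [2 ^+ k] times the test function, with real part at least 1/2. *)
pose t k := \sum_(j < m) eval (zs (N k)) (c j) *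
  ((2 ^+ k)%:C * eval (zs (N k)) (b j)).
have t_cvg : t @ \oo --> \sum_(j < m) eval zK (c j) * 0.
  apply: cvgc_sum => j.
  apply: cvgM; first exact: cvg_comp zN (@eval_continuous (c j) zK).
  apply/cvgcP => e e0.
  have h2 : `|2^-1 : R| < 1 by rewrite ger0_norm ?invr_ge0// invf_lt1// ltr1n.
  have /cvgrPdist_lt/(_ _ e0) := cvg_geometric 1 h2.
  apply: filterS => k; rewrite !sub0r normrN normcN /geometric /= mul1r => he.
  apply: le_lt_trans (le_lt_trans (ler_norm _) he).
  rewrite normcM normc_real ger0_norm ?exprn_ge0//.
  have -> : (2^-1 : R) ^+ k = 2 ^+ k * 4^-1 ^+ k.
    by rewrite -exprMn; congr (_ ^+ k); lra.
  by rewrite ler_wpM2l ?exprn_ge0// ltW// (hl k).2.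
have t_ge k : 2^-1 <= Re (t k).
  have -> : t k = (2 ^+ k)%:C * frac_series s2 d2 (w (set_val (zs (N k)))).
    rewrite -[frac_series _ _ _]/(eval (zs (N k)) (pullback bH)) bE mulr_sumr.
    by apply: eq_bigr => j _; rewrite mulrCA.
  rewrite Re_mul_real.
  have := Re_frac_series_ge d2p s2sum s2p (erefl (d2 k)).
  move=> /(ler_wpM2l (exprn_ge0 k (ler0n R 2))); apply: le_trans.
  by rewrite /s2 exprVn mulrA divff ?mul1r// expf_neq0// pnatr_eq0.
rewrite big1 in t_cvg; last by move=> j _; rewrite mulr0.
have /cvgcP/(_ 2^-1) := t_cvg; rewrite invr_gt0 ltr0n => /(_ isT) [M _ /(_ M (leqnn M))] /=.
rewrite sub0r normcN ltNge => /negP; apply.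
exact: le_trans (t_ge M) (le_trans (ler_norm _) (Re_le_normc _)).
Qed.

End Peak.

(** * Compact closure of bounded sets *)

Section Compactness.
Variable R : realType.

Lemma complex_square_compact (m : R) :
  compact [set z : R[i] | `|Re z| <= m /\ `|Im z| <= m].
Proof.
have -> : [set z : R[i] | `|Re z| <= m /\ `|Im z| <= m] =
    (fun p : R * R => p.1 +i* p.2) @` (`[- m, m] `*` `[- m, m]).
  apply/seteqP; split=> [[a b] /= [am bm]|_ [[a b] /= [am bm] <-]] /=.
    by exists (a, b) => //=; rewrite !in_itv /= -!ler_norml.
  by move: am bm; rewrite !in_itv /= -!ler_norml.
apply: continuous_compact; last by apply: compact_setX; exact: segment_compact.
apply: continuous_subspaceT => p.
by apply: (@cvg_complex _ _ (nbhs p)); [exact: cvg_fst|exact: cvg_snd].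
Qed.

Lemma bounded_closure_compact n (A : set 'rV[R[i]]_n) :
  bounded_set A -> compact (closure A).
Proof.
move=> [M [/complex_realP[{M}M ->] AM]].
(* Boundedness gives [|v| <= x] only for [x > M], whence the first 1; the second makes the
   inequality strict, as membership in an open ball requires. *)
pose m := M + 1 + 1.
pose Q := [set v : 'rV[R[i]]_n | forall i, `|Re (v ord0 i)| <= m /\ `|Im (v ord0 i)| <= m].
have cQ : compact Q.
  exact: (@rV_compact R[i] n (fun=> [set z : R[i] | `|Re z| <= m /\ `|Im z| <= m])
    (fun=> @complex_square_compact m)).
have clQ : closed Q by apply: compact_closed => //; exact: norm_hausdorff.
apply: (subclosed_compact _ cQ); first exact: closed_closure.
rewrite [X in _ `<=` X]((closure_id Q).1 clQ); apply: closureS => v Av i.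
have : `|v| < m%:C.
  apply: (@le_lt_trans _ _ (M + 1)%:C); last by rewrite ltcR /m; lra.
  by apply: AM => //; rewrite ltcR; lra.
have -> : (`|v| < m%:C) = (`|0 - v| < m%:C) by rewrite sub0r normrN.
rewrite -[is_true _]/(ball_ (fun x => `|x|) 0 m%:C v) -mx_norm_ball => -[_ /(_ ord0 i)].
rewrite -ball_normE /= mxE sub0r normrN ltcR => /ltW vm.
by split; [exact: le_trans (Re_le_normc _) vm|exact: le_trans (Im_le_normc _) vm].
Qed.

End Compactness.

(** * Existence of a peak point, and the two cases of the theorem *)

Lemma not_coherent_of_compact_closure (R : realType) (n : nat) (i0 : 'I_n)
    (K U : set 'rV[R[i]]_n) :
  open U -> U !=set0 -> compact (closure U) -> closure U `<=` K ->
  ~ coherent (holo_alg K U).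
Proof.
move=> oU [x0 Ux0] cU UK.
pose p (z : 'rV[R[i]]_n) := Re (z ord0 i0).
have cp : continuous p.
  move=> z; apply: continuous_comp; first exact: coord_continuous.
  exact: Re_continuous.
have cU0 : closure U !=set0 by exists x0; exact: subset_closure.
have [z0 /set_mem cz0 maxz0] :=
  compact_EVT_max cU0 cU (continuous_subspaceT cp).
have {}maxz0 z : U z -> p z <= p z0.
  by move=> Uz; apply: maxz0; apply/mem_set; exact: subset_closure.
apply: (@not_coherent_of_peak _ _ _ _ i0 z0) => //.
- by move=> z Uz; apply: UK; exact: subset_closure.
- exact: UK.
move=> z Uz; have -> : Re (z0 ord0 i0 - z ord0 i0) = p z0 - p z.
  by rewrite /p; case: (z0 _ _) => a b; case: (z _ _).
rewrite subr_gt0 lt_neqAle maxz0// andbT; apply/eqP => pz.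
have /nbhs_ballP[[e e'] /=] : nbhs z U by exact: open_nbhs_nbhs.
rewrite ltcE /= => /andP[/eqP -> e0] he.
(* A maximum of [p] cannot be attained inside the open set: half the radius of a ball in U, added to
   the real part of coordinate [i0], would increase it. *)
have Uh : U (z + (e / 2)%:C *: delta_mx ord0 i0).
  apply: he; split=> [|i j]; first by rewrite ltcR.
  rewrite -ball_normE /= !mxE opprD addrA subrr sub0r normrN.
  case: (_ && _); last by rewrite mulr0 normr0 ltcR.
  by rewrite mulr1 ltcR normc_real gtr0_norm; lra.
have := maxz0 _ Uh; rewrite -pz /p !mxE !eqxx mulr1.
by case: (z ord0 i0) => a b /=; lra.
Qed.

Theorem theorem5p5 (R : realType) (n : nat) (n_ge1 : (1 <= n)%N) :
  (forall Omega : set 'rV[R[i]]_n,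
     is_domain Omega -> bounded_set Omega ->
     ~ coherent (holo_alg (closure Omega) Omega))
  /\
  (forall K : set 'rV[R[i]]_n,
     compact K -> K° !=set0 -> ~ coherent (holo_alg K K°)).
Proof.
have i0 := Ordinal n_ge1; split=> [D [D0 _ D_open] bD|K cK K0].
  apply: (not_coherent_of_compact_closure i0) => //.
  exact: bounded_closure_compact.
have KK : closure K° `<=` K.
  have /closure_id KE : closed K.
    by apply: compact_closed cK; exact: norm_hausdorff.
  by rewrite [X in _ `<=` X]KE; apply: closureS; exact: interior_subset.
apply: (not_coherent_of_compact_closure i0) => //; first exact: open_interior.
exact: subclosed_compact (@closed_closure _ _) cK KK.
Qed.
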